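(* Let $F$ be a field with a nontrivial valuation $v$ and valuation domain $O_v$. Let $R$ be a torsion-free $O_v$-algebra such that $(R^{\times}\cap O_v)\subseteq O_v^{\times}$ and $R\otimes_{O_v}F$ is a finite dimensional $F$-algebra. Then $\operatorname{K-dim}R=\operatorname{K-dim}O_v$.
   Context: $O_v=\{x\in F: v(x)\ge0\}$. Rings are associative with $1$, not necessarily commutative. An $O_v$-algebra is a ring $R$ with a unitary ring homomorphism $O_v\to Z(R)$, $c\mapsto c\cdot 1_R$; it is torsion-free if $cr=0$ with $c\in O_v$, $r\in R$ implies $c=0$ or $r=0$. $R^\times\cap O_v=\{c\in O_v: c\cdot 1_R\in R^\times\}$. $\operatorname{K-dim}R$ is the classical Krull dimension of $R$: the maximal length of chains of prime (two-sided) ideals of $R$ (possibly $\infty$). *)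

(* Defs.v *)
From HB Require Import structures.
From mathcomp Require Import all_boot all_order all_algebra all_field.
From mathcomp Require Import boolp classical_sets.

Set Implicit Arguments.
Unset Strict Implicit.
Unset Printing Implicit Defensive.

Import Order.TTheory GRing.Theory Num.Theory.
Local Open Scope ring_scope.
Local Open Scope classical_set_scope.

(* Totally ordered abelian groups, written additively. *)
Record orderedGroup := OrderedGroup {
  group_sort :> porderZmodType;
  group_le_total : forall x y : group_sort, (x <= y) || (y <= x);
  group_leD2r : forall x y z : group_sort, x <= y -> x + z <= y + z
}.

(* [option G] is the group G with a largest element [None], read as infinity. *)
Section ExtendedGroup.
Variable G : orderedGroup.
Implicit Types a b : option G.

Definition vle a b : bool :=
  match a, b with
  | _, None => true
  | None, Some _ => false
  | Some x, Some y => x <= y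
  end.

Definition vmin a b : option G := if vle a b then a else b.

Definition vadd a b : option G :=
  match a, b with
  | Some x, Some y => Some (x + y)
  | _, _ => None
  end.

End ExtendedGroup.

(* The value group is not required to be the whole of G. *)
Record valuation (F : fieldType) (G : orderedGroup) := Valuation {
  valuation_fun :> F -> option G;
  valuation_infty : forall x, valuation_fun x = None <-> x = 0;
  valuationM : forall x y,
    valuation_fun (x * y) = vadd (valuation_fun x) (valuation_fun y);
  valuationD : forall x y,
    vle (vmin (valuation_fun x) (valuation_fun y)) (valuation_fun (x + y))
}.

Definition nontrivial_valuation (F : fieldType) (G : orderedGroup)
    (v : valuation F G) : Prop :=
  exists2 x : F, x != 0 & v x <> Some 0.

Section ValuationRing.
Variables (F : fieldType) (G : orderedGroup) (v : valuation F G).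

Definition nonneg_value : {pred F} := fun x => vle (Some 0) (v x).

Lemma valuation1 : v 1 = Some 0.
Proof.
have := valuationM v 1 1; rewrite mulr1.
case E: (v 1) => [g|] /=.
  by case=> /(congr1 (fun z => z - g)); rewrite subrr addrK => <-.
by have /eqP := (valuation_infty v 1).1 E; rewrite oner_eq0.
Qed.

Lemma valuationN1 : v (-1) = Some 0.
Proof.
have := valuationM v (-1) (-1); rewrite mulrNN mulr1 valuation1.
case: (v (-1)) => [g|] //= [g0]; congr (Some _).
apply/eqP; rewrite eq_le.
case/orP: (group_le_total 0 g) => g0';
  by have := group_leD2r g g0'; rewrite add0r -g0 g0' => ->.
Qed.

Lemma nonneg_value_subring : subring_closed nonneg_value.
Proof.
have PM x y : x \in nonneg_value -> y \in nonneg_value ->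
    x * y \in nonneg_value.
  rewrite !unfold_in /nonneg_value valuationM.
  case: (v x) (v y) => [a|] [b|] //= a0 b0.
  by have := group_leD2r b a0; rewrite add0r; apply: le_trans.
have PN1 : -1 \in nonneg_value by rewrite unfold_in /nonneg_value valuationN1 /=.
split=> // [|x y Px Py].
  by rewrite unfold_in /nonneg_value valuation1 /=.
have := PM _ _ PN1 Py; rewrite mulN1r => {Py}.
move: Px (valuationD v x (- y)); rewrite !unfold_in /nonneg_value /vmin.
case: ifP => _; case: (v x) (v (- y)) (v (x - y)) => [a|] [b|] [c|] //=;
  by move=> p q r; first [exact: le_trans p q | exact: le_trans p r
    | exact: le_trans q r | exact: le_trans r q | exact: le_trans r p
    | exact: le_trans q p].
Qed.

Record valuation_ring := ValuationRing {
  in_field : F;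
  _ : in_field \in nonneg_value
}.

HB.instance Definition _ := [isSub for in_field].
HB.instance Definition _ := [Choice of valuation_ring by <:].
HB.instance Definition _ := GRing.SubChoice_isSubComNzRing.Build
  F nonneg_value valuation_ring nonneg_value_subring.

End ValuationRing.

Definition invertible (R : nzRingType) (x : R) : Prop :=
  exists y, x * y = 1 /\ y * x = 1.

Definition torsion_free (O : comNzRingType) (R : lmodType O) : Prop :=
  forall (c : O) (r : R), c *: r = 0 -> c = 0 \/ r = 0.

Section TensorProduct.
Variables (F : fieldType) (G : orderedGroup) (v : valuation F G).
Local Notation O := (valuation_ring v).

Definition bilinear_map (R M : lmodType O) (f : R -> F -> M) : Prop :=
  [/\ forall r s a, f (r + s) a = f r a + f s a,
      forall r a b, f r (a + b) = f r a + f r b,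
      forall c r a, f (c *: r) a = c *: f r a
    & forall c r a, f r (in_field c * a) = c *: f r a].

(* Here T is an O-module by restriction of scalars along [in_field]. *)
Definition restricted_linear (T : lmodType F) (M : lmodType O) (g : T -> M)
    : Prop :=
  (forall t u, g (t + u) = g t + g u) /\
  (forall (c : O) t, g (in_field c *: t) = c *: g t).

(* T, with t r a in the role of the pure tensor of r and a, is the tensor
   product of R and F over O: the first four fields are its universal property
   as an O-module, the last three describe its F-algebra structure. *)
Record is_tensor_algebra (R : algType O) (T : algType F) (t : R -> F -> T)
    : Prop := IsTensorAlgebra {
  tensorDl : forall r s a, t (r + s) a = t r a + t s a;
  tensorDr : forall r a b, t r (a + b) = t r a + t r b;
  tensor_balanced : forall c r a, t (c *: r) a = t r (in_field c * a);
  tensor_universal : forall (M : lmodType O) (f : R -> F -> M),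
    bilinear_map f ->
    exists! g : T -> M,
      restricted_linear g /\ (forall r a, g (t r a) = f r a);
  tensorZ : forall b r a, b *: t r a = t r (b * a);
  tensor1 : t 1 1 = 1;
  tensorM : forall r s a b, t r a * t s b = t (r * s) (a * b)
}.

End TensorProduct.

Section KrullDimension.
Variable R : nzRingType.

Definition two_sided_ideal (I : set R) : Prop :=
  [/\ I 0, forall x y, I x -> I y -> I (x + y)
    & forall a x, I x -> I (a * x) /\ I (x * a)].

(* As P is closed under sums, it contains the product of the ideals I and J
   exactly when it contains all products x * y of their elements. *)
Definition prime_ideal (P : set R) : Prop :=
  [/\ two_sided_ideal P, P <> setT
    & forall I J, two_sided_ideal I -> two_sided_ideal J ->
        [set x * y | x in I & y in J] `<=` P -> I `<=` P \/ J `<=` P].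

(* Chains P 0 < P 1 < ... < P n of prime ideals; their length is n. *)
Definition prime_chain (n : nat) (P : nat -> set R) : Prop :=
  (forall i, (i <= n)%N -> prime_ideal (P i)) /\
  (forall i, (i < n)%N -> P i `<` P i.+1).

Definition prime_chain_lengths : set nat :=
  [set n | exists P, prime_chain n P].

(* [None] stands for infinity. A nonzero ring has a prime ideal, so the set of
   chain lengths is nonempty and has no maximum only when it is unbounded. *)
Definition Kdim : option nat :=
  xget None [set Some n | n in prime_chain_lengths `&`
                               ubound prime_chain_lengths].

End KrullDimension.

(* Main.v *)
Require Import Defs.
From HB Require Import structures.
From mathcomp Require Import all_boot all_order all_algebra all_field.
From mathcomp Require Import boolp classical_sets functions.
Import GRing.Theory.
Local Open Scope ring_scope.

(** Write O for the valuation ring. Contraction of prime ideals from R to O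
    turns strict chains into strict chains of the same length, and every chain
    of prime ideals of O is the contraction of a chain of R. So R and O have
    the same set of chain lengths, which is all that the Krull dimension
    depends on.

    Contraction is strict ([incomparability]) because R has bounded rank
    modulo every prime. If n is the dimension of the tensor product over F, any
    n + 1 elements of R satisfy a linear relation over F; divided by its
    coefficient of least value it becomes a relation over O with a coefficient
    equal to 1, hence a nontrivial relation modulo every prime ideal
    ([unit_coefficient_relation]). This uses that R embeds in the tensor product
    ([tensor_injective]). If P is prime over p, the fraction ring of R/P with
    respect to O/p is therefore a finite dimensional prime algebra over a
    field, and such an algebra is simple; a prime Q that properly contains P
    cannot survive in it and must meet O in more than p. The argument for
    simplicity is carried out inside R, with left ideals saturated with respect
    to O - p in place of left ideals of the fraction ring.

    Chains lift ([lying_over], [going_down]) because R is flat over O. Here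
    flatness takes the form: for a prime p of O, the ideal pR is stable under
    division by elements of O - p ([extension_saturated]). So pR avoids
    (O - p)M for every set M that it avoids, and an ideal that is maximal
    among those containing pR and avoiding (O - p)M is a prime over p. With
    M = {1} this gives a prime over the largest member of the chain; with M
    the complement of a prime Q, it gives a prime inside Q over the next
    smaller member. The condition on units ensures that pR does not
    contain 1. *)

Set Implicit Arguments.
Unset Strict Implicit.

(** * Prime ideals of noncommutative rings *)

Section PrimeIdeals.
Local Open Scope classical_set_scope.
Variable R : nzRingType.
Implicit Types (I J P : set R) (M : set R).

Lemma ideal_add_cancel I x y : two_sided_ideal I -> I (x + y) -> I y -> I x.
Proof.
case=> _ ID IM Ixy Iy; rewrite -[x](addrK y).
by apply: ID => //; rewrite -mulN1r; have [] := IM (-1) _ Iy.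
Qed.

(** Annihilators modulo P replace generated ideals below. That xRy is in P says
    that y lies in the right annihilator of xR, which is an ideal; so the sums
    of products that make up the ideal RyR never have to be written down. *)
Definition right_annihilator P (A : set R) : set R :=
  [set b | forall a, A a -> forall r, P (a * r * b)].

Definition left_annihilator P (B : set R) : set R :=
  [set a | forall b, B b -> forall r, P (a * r * b)].

Lemma right_annihilator_ideal P A :
  two_sided_ideal P -> two_sided_ideal (right_annihilator P A).
Proof.
case=> P0 PD PM; split=> [a _ r|b c Pb Pc a Aa r|b c Pc] /=.
- by rewrite mulr0.
- by rewrite mulrDr; apply: PD; [apply: Pb|apply: Pc].
- split=> a Aa r; first by rewrite mulrA -(mulrA a); apply: Pc.
  by rewrite mulrA; apply: (PM _ _ _).2; apply: Pc.
Qed.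

Lemma left_annihilator_ideal P B :
  two_sided_ideal P -> two_sided_ideal (left_annihilator P B).
Proof.
case=> P0 PD PM; split=> [b _ r|a c Pa Pc b Bb r|a c Pc] /=.
- by rewrite !mul0r.
- by rewrite !mulrDl; apply: PD; [apply: Pa|apply: Pc].
- split=> b Bb r; last by rewrite -(mulrA c); apply: Pc.
  by rewrite -!mulrA; apply: (PM _ _ _).1; rewrite mulrA; apply: Pc.
Qed.

(** If xRy is in P, the right annihilator J of xR contains y, the left
    annihilator of RJ contains x, and the product of the two is in P. *)
Lemma prime_idealP P :
  prime_ideal P <->
  [/\ two_sided_ideal P, ~ P 1
    & forall x y, (forall r, P (x * r * y)) -> P x \/ P y].
Proof.
split=> [[idP PT Pprime]|[PI P1 Pprime]].
  have [P0 PD PM] := idP.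
  split=> // [P1|x y xRy].
    by apply: PT; apply/seteqP; split=> // a _; have [] := PM a _ P1; rewrite mulr1.
  pose J := right_annihilator P [set x].
  have [|||IP|JP] := Pprime (left_annihilator P J) J.
  - exact: left_annihilator_ideal.
  - exact: right_annihilator_ideal.
  - by move=> _ [a Ia [b Jb <-]]; rewrite -[a]mulr1; apply: Ia.
  - by left; apply: IP => b; apply.
  - by right; apply: JP => _ ->.
split=> // [PT|I J idI idJ IJP].
  by apply: P1; rewrite PT.
apply: contrapT => /not_orP [/existsNP [x /not_implyP [Ix nPx]]].
move=> /existsNP [y /not_implyP [Jy nPy]].
have [r|//|//] := Pprime x y; apply: IJP.
by exists (x * r); [case: idI => _ _ /(_ r x Ix) []|exists y].
Qed.

(** Take P maximal among the ideals that contain J and avoid M. If xRy is in P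
    but y is not, the right annihilator of xR is larger than P, hence contains
    some m in M; if x is not in P either, the left annihilator of Rm contains
    some m' in M. Then m'Rm is in P, although it meets M. *)
Lemma prime_ideal_avoiding J M :
  two_sided_ideal J -> M 1 ->
  (forall x y, M x -> M y -> exists r, M (x * r * y)) ->
  (forall x, J x -> ~ M x) ->
  exists P, [/\ prime_ideal P, J `<=` P & forall x, P x -> ~ M x].
Proof.
move=> idJ M1 MM JM.
pose good I := two_sided_ideal (J `|` I) /\ forall x, (J `|` I) x -> ~ M x.
have [F Fgood Ftot|A [[idA AM] Amax]] := @Zorn_bigcup R good.
  split; last by move=> x [/JM//|[X /Fgood [_ XM] Xx]]; apply: XM; right.
  (* J is part of every union, so that the empty chain is bounded too *)
  have [J0 JD JMl] := idJ; split; first by left.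
    move=> x y [Jx|[X FX Xx]] [Jy|[Y FY Yy]]; first by left; apply: JD.
    - have [[_ YD _] _] := Fgood _ FY.
      by have [|Yxy] := YD x y (or_introl Jx) (or_intror Yy);
         [left|right; exists Y].
    - have [[_ XD _] _] := Fgood _ FX.
      by have [|Xxy] := XD x y (or_intror Xx) (or_introl Jy);
         [left|right; exists X].
    have [Z [FZ Zx Zy]] : exists Z, [/\ F Z, Z x & Z y].
      by have [XY|YX] := Ftot X Y FX FY; [exists Y|exists X]; split=> //;
         [apply: XY|apply: YX].
    have [[_ ZD _] _] := Fgood _ FZ.
    by have [|Zxy] := ZD x y (or_intror Zx) (or_intror Zy);
       [left|right; exists Z].
  move=> a x [/(JMl a) [? ?]|[X FX Xx]]; first by split; left.
  have [[_ _ XMl] _] := Fgood _ FX.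
  have [xa ax] := XMl a x (or_intror Xx).
  by split; [case: xa|case: ax] => ?; do ?[by left]; right; exists X.
set P := J `|` A in idA AM.
have meetsM K x : two_sided_ideal K -> P `<=` K -> K x -> ~ P x ->
    exists2 m, M m & K m.
  move=> idK PK Kx nPx; apply: contrapT => KM.
  have JK : J `|` K = K by apply/setUidPr => y Jy; apply: PK; left.
  apply: (Amax K).
    split; last by move=> AK; apply: nPx; right; apply: AK.
    by move=> y Ay; apply: PK; right.
  by split; rewrite JK // => y Ky My; apply: KM; exists y.
exists P; split=> //; last by move=> ? ?; left.
have [P0 PD PM] := idA.
apply/prime_idealP; split=> // [P1|x y xRy]; first exact: (AM _ P1).
apply: contrapT => /not_orP [nPx nPy].
have [m Mm xRm] : exists2 m, M m & right_annihilator P [set x] m.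
  apply: (meetsM _ y) => //; first exact: right_annihilator_ideal.
    by move=> b Pb a _ r; apply: (PM _ _ _).1.
  by move=> _ ->.
have [m' Mm' m'Rm] : exists2 m', M m' & left_annihilator P [set m] m'.
  apply: (meetsM _ x) => //; first exact: left_annihilator_ideal.
    by move=> a Pa b _ r; rewrite -mulrA; apply: (PM _ _ _).2.
  by move=> _ -> r; apply: xRm.
by have [r] := MM _ _ Mm' Mm; apply: AM; apply: m'Rm.
Qed.

End PrimeIdeals.

(** * Contraction and incomparability *)

Section Algebra.
Local Open Scope classical_set_scope.
Variables (O : comNzRingType) (R : algType O).
Implicit Types (P Q N L : set R) (c d : O) (x y : R).

Definition contraction P : set O := [set c | P c%:A].

Lemma idealZ P c x : two_sided_ideal P -> P x -> P (c *: x).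
Proof. by case=> _ _ PM Px; rewrite -mulr_algl; apply: (PM _ _ _).1. Qed.

Lemma idealZl P c x : two_sided_ideal P -> contraction P c -> P (c *: x).
Proof. by case=> _ _ PM Pc; rewrite -mulr_algl; apply: (PM _ _ _).2. Qed.

Lemma contraction_prime P : prime_ideal P -> prime_ideal (contraction P).
Proof.
move=> /prime_idealP [idP P1 Pprime]; have [P0 PD PM] := idP.
apply/prime_idealP; split; rewrite /contraction /= ?scale1r //.
  split=> /= [|c d Pc Pd|c d Pd]; first by rewrite scale0r.
    by rewrite scalerDl; apply: PD.
  by rewrite (mulrC d) -scalerA; split; apply: idealZ.
move=> c d Pcd; apply: Pprime => r.
rewrite mulr_algl mulr_algr scalerA -mulr_algl.
apply: (PM _ _ _).2; have := Pcd 1.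
by rewrite mulr1 mulrC.
Qed.

Lemma prime_scale P c x : prime_ideal P -> P (c *: x) -> contraction P c \/ P x.
Proof.
move=> /prime_idealP [idP _ Pprime] Pcx; apply: Pprime => r.
rewrite mulr_algl -scalerAl scalerAr.
by have [_ _ PM] := idP; apply: (PM _ _ _).1.
Qed.

Section Incomparability.

(** These are the preimages in R of the left ideals of the fraction ring of R/P
    with respect to the image of O. *)
Definition saturated_left_ideal P N :=
  [/\ P `<=` N, forall x y, N x -> N y -> N (x + y),
      forall a x, N x -> N (a * x)
    & forall c x, ~ contraction P c -> N (c *: x) -> N x].

(** Linear independence of the images in R/P over the image of O. Only the values
    of c below the size of s matter. *)
Definition independent_mod P (s : seq R) :=
  forall c : nat -> O, P (\sum_(i < size s) c i *: s`_i) ->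
  forall i, (i < size s)%N -> contraction P (c i).

Definition rank_le P N (k : nat) :=
  forall s : seq R, (forall x, x \in s -> N x) -> independent_mod P s ->
  (size s <= k)%N.

Variable P : set R.
Hypothesis primeP : prime_ideal P.
Let idP : two_sided_ideal P. Proof. by case: primeP. Qed.

Lemma saturated_sum N n (f : 'I_n -> R) : saturated_left_ideal P N ->
  (forall i, N (f i)) -> N (\sum_i f i).
Proof.
by case=> PN ND _ _ Nf; apply: big_ind => //; apply: PN; case: idP.
Qed.

Lemma saturated_scale N c x : saturated_left_ideal P N -> N x -> N (c *: x).
Proof. by case=> _ _ NM _ Nx; rewrite -mulr_algl; apply: NM. Qed.

Lemma saturated_add_cancel N x y :
  saturated_left_ideal P N -> N (x + y) -> N y -> N x.
Proof.
case=> _ ND NM _ Nxy Ny; rewrite -[x](addrK y).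
by apply: ND => //; rewrite -mulN1r; apply: NM.
Qed.

Lemma rank_le0 N : rank_le P N 0 -> N `<=` P.
Proof.
move=> rN x Nx; apply: contrapT => nPx.
suff indep : independent_mod P [:: x].
  suff : (size [:: x] <= 0)%N by [].
  by apply: rN indep => y; rewrite inE => /eqP ->.
move=> c /=; rewrite big_ord1 /= => Pcx [|//] _.
by have [] := prime_scale primeP Pcx.
Qed.

(** An independent sequence in N' stays independent when x is added, since a
    relation whose coefficient of x is not in P would put x in N'. *)
Lemma rank_le_proper N N' x k : saturated_left_ideal P N' -> N' `<=` N ->
  N x -> ~ N' x -> rank_le P N k.+1 -> rank_le P N' k.
Proof.
move=> satN' N'N Nx nN'x rN s sN' indep; rewrite -ltnS.
apply: (rN (x :: s)).
  by move=> y; rewrite inE => /orP [/eqP ->//|/sN' /N'N].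
move=> c /=; rewrite big_ord_recl /= => Psum.
have Pc0 : contraction P (c 0%N).
  apply: contrapT => nPc; apply: nN'x.
  have [PN' _ _ sat] := satN'; apply: (sat (c 0%N)) => //.
  apply: (saturated_add_cancel satN' (PN' _ Psum)).
  apply: (saturated_sum satN') => i; apply: (saturated_scale _ satN').
  exact/sN'/mem_nth/ltn_ord.
case=> [//|i] /= ilt; apply: (indep (c \o S)) => //=.
apply: ideal_add_cancel (idealZl x idP Pc0) => //.
by rewrite addrC.
Qed.

Definition minimal_over N := [/\ saturated_left_ideal P N, ~ N `<=` P
  & forall N', saturated_left_ideal P N' -> N' `<=` N -> ~ N' `<=` P -> N `<=` N'].

Lemma minimal_over_exists k N : saturated_left_ideal P N -> ~ N `<=` P ->
  rank_le P N k -> exists L, minimal_over L.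
Proof.
elim: k N => [|k IHk] N satN nNP rN; first by case: (nNP (rank_le0 rN)).
apply: contrapT => noL; apply: (noL); exists N; split=> // N' satN' N'N nN'P x Nx.
apply: contrapT => nN'x; apply: noL.
exact: (IHk N') (rank_le_proper satN' N'N Nx nN'x rN).
Qed.

(** The fraction ring A of R/P is simple. Let L be a minimal left ideal of A,
    and Q a nonzero ideal. By induction on the rank, QN = N for every left ideal
    N. Indeed, choose l in L with Nl nonzero. Then Nl = L = QNl by minimality and
    primeness, so each x in N differs from an element of QN by an element of
    the annihilator N' of l in N, and QN' = N' since N' has smaller rank. As Q
    is an ideal, it suffices to conclude that N is contained in Q. *)
Lemma saturated_sub_ideal Q L k N : two_sided_ideal Q -> saturated_left_ideal P Q ->
  ~ Q `<=` P -> minimal_over L ->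
  saturated_left_ideal P N -> rank_le P N k -> N `<=` Q.
Proof.
move=> idQ satQ nQP [satL nLP minL].
have [_ _ Pprime] := (prime_idealP P).1 primeP; have [P0 PD PM] := idP.
have [PQ QD QM Qsat] := satQ; have [PL LD LM Lsat] := satL.
elim: k N => [|k IHk] N satN rN; first exact: subset_trans (rank_le0 rN) PQ.
have [NP|] := pselect (N `<=` P); first exact: subset_trans NP PQ.
move=> /existsNP [n0 /not_implyP [Nn0 nPn0]].
have [PN ND NM Nsat] := satN.
have /existsNP [q0 /not_implyP [Qq0 nPq0]] := nQP.
have /existsNP [l0 /not_implyP [Ll0 nPl0]] := nLP.
have [r nPnl] : exists r, ~ P (n0 * r * l0).
  apply: contrapT => /forallNP H; have [r|//|//] := Pprime n0 l0.
  exact: contrapT (H r).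
pose l := r * l0; have Ll : L l by apply: LM.
rewrite -mulrA -/l in nPnl.
have [r' nPqnl] : exists r', ~ P (q0 * r' * (n0 * l)).
  apply: contrapT => /forallNP H; have [s|//|//] := Pprime q0 (n0 * l).
  exact: contrapT (H s).
pose N' := [set x | N x /\ P (x * l)].
have satN' : saturated_left_ideal P N'.
  split=> [x Px|x y [Nx Px] [Ny Py]|a x [Nx Px]|c x nPc [Ncx]] /=.
  - by split; [apply: PN|apply: (PM _ _ _).2].
  - by split; [apply: ND|rewrite mulrDl; apply: PD].
  - by split; [apply: NM|rewrite -mulrA; apply: (PM _ _ _).1].
  - rewrite -scalerAl => /(prime_scale primeP) [//|Pxl].
    by split=> //; apply: Nsat Ncx.
have N'Q : N' `<=` Q.
  apply: IHk => //; apply: (rank_le_proper satN' _ Nn0 _ rN); first by move=> x [].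
  by case.
(* K is the saturation of (Q :&: N) l + P *)
pose K := [set z | exists c y,
  [/\ ~ contraction P c, Q y, N y & P (c *: z - y * l)]].
have nP1 : ~ contraction P 1.
  by rewrite /contraction /= scale1r; case/prime_idealP: primeP.
have mulc c d : ~ contraction P c -> ~ contraction P d -> ~ contraction P (c * d).
  move=> nPc nPd; rewrite /contraction /= -scalerA => /(prime_scale primeP) [].
    exact: nPc.
  exact: nPd.
have satK : saturated_left_ideal P K.
  split=> [x Px|x y [c [u [nc Qu Nu Pu]]] [d [w [nd Qw Nw Pw]]]
          |a x [c [u [nc Qu Nu Pu]]]|c x nPc [d [y [nd Qy Ny Py]]]] /=.
  - exists 1, 0; split=> //; [by case: idQ|exact: PN|].
    by rewrite scale1r mul0r subr0.
  - exists (c * d), (d *: u + c *: w); split; first exact: mulc.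
    + by apply: QD; apply: saturated_scale.
    + by apply: ND; apply: saturated_scale.
    have -> : (c * d) *: (x + y) - (d *: u + c *: w) * l =
        d *: (c *: x - u * l) + c *: (d *: y - w * l).
      rewrite !scalerBr !scalerDr !scalerA mulrDl -!scalerAl (mulrC d c).
      by rewrite opprD addrACA.
    by apply: PD; apply: idealZ.
  - exists c, (a * u); split=> //; [exact: QM|exact: NM|].
    by rewrite scalerAr -mulrA -mulrBr; apply: (PM _ _ _).1.
  - exists (d * c), y; split=> //; first exact: mulc.
    by rewrite -scalerA.
have KL : K `<=` L.
  move=> z [c [y [nc _ _ Pz]]]; apply: (Lsat c) => //.
  by rewrite -[c *: z](subrK (y * l)); apply: LD; [apply: PL|apply: LM].
have nKP : ~ K `<=` P.
  move=> KP; apply: nPqnl; apply: KP; exists 1, (q0 * r' * n0); split=> //.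
  - by rewrite -mulrA; have [_ _ /(_ (r' * n0) _ Qq0) []] := idQ.
  - exact: NM.
  - by rewrite scale1r mulrA subrr.
move=> x Nx.
have [c [y [nc Qy Ny Pxy]]] := minL K satK KL nKP _ (LM x _ Ll).
apply: (Qsat c) => //.
rewrite -[c *: x](subrK y); apply: QD => //; apply: N'Q; split; last first.
  by rewrite mulrBl -scalerAl.
apply: ND; first exact: saturated_scale.
by rewrite -mulN1r; apply: NM.
Qed.

End Incomparability.

(** If Q had the same contraction as P, it would be saturated over P, hence
    equal to R by simplicity. *)
Lemma incomparability n P Q :
  (forall s : seq R, (n < size s)%N -> exists c : nat -> O,
     \sum_(i < size s) c i *: s`_i = 0 /\ exists2 i, (i < size s)%N & c i = 1) ->
  prime_ideal P -> prime_ideal Q -> P `<` Q -> contraction P `<` contraction Q.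
Proof.
move=> dep primeP primeQ [PQ nQP]; split=> [c Pc|QPO]; first exact: PQ.
have [idP _ _] := primeP; have [idQ _ _] := primeQ.
have [P0 _ _] := idP; have [_ QD QM] := idQ.
have rank N : rank_le P N n.
  move=> s _ indep; rewrite leqNgt; apply/negP => /dep [c [sum0 [i ilt ci]]].
  have := indep c; rewrite sum0 => /(_ P0 i ilt); rewrite ci /contraction /= scale1r.
  by case/prime_idealP: primeP.
have satQ : saturated_left_ideal P Q.
  split=> // [a x Qx|c x nPc /(prime_scale primeQ) [/QPO|]//].
  exact: (QM _ _ Qx).1.
have satT : saturated_left_ideal P setT by split.
have [L minL] := minimal_over_exists primeP satQ nQP (rank Q).
have [_ + _] := (prime_idealP Q).1 primeQ; apply.
exact: (saturated_sub_ideal primeP idQ satQ nQP minL satT (rank _)).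
Qed.

End Algebra.

(** * Lying over and going down *)

Section GoingDown.
Local Open Scope classical_set_scope.
Variables (O : comNzRingType) (R : algType O).
Hypothesis tfR : torsion_free R.
Hypothesis divides_total :
  forall c d : O, (exists e, d = e * c) \/ (exists e, c = e * d).
Implicit Types (p : set O) (c d : O) (x y : R).

Lemma prime_mul p c d : prime_ideal p -> p (c * d) -> p c \/ p d.
Proof.
case/prime_idealP => -[_ _ pM] _ pprime pcd; apply: pprime => e.
by rewrite mulrAC; apply: (pM _ _ _).2.
Qed.

(** Because O is a valuation ring, a sum of multiples of elements of p is a
    multiple of a single one: this is the whole ideal pR. *)
Definition extension p : set R := [set x | exists2 d, p d & exists r, x = d *: r].

Lemma extension_ideal p : two_sided_ideal p -> two_sided_ideal (extension p).
Proof.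
case=> p0 pD pM; split=> [|_ _ [c pc [x ->]] [d pd [y ->]]|a _ [c pc [x ->]]].
- by exists 0 => //; exists 0; rewrite scale0r.
- have [[e ->]|[e ->]] := divides_total c d.
    by exists c => //; exists (x + e *: y); rewrite scalerDr scalerA (mulrC e).
  by exists d => //; exists (e *: x + y); rewrite scalerDr scalerA (mulrC e).
- by split; exists c => //; [exists (a * x)|exists (x * a)];
    rewrite (scalerAr, scalerAl) // -?scalerAl -?scalerAr.
Qed.

(** Let cx = dr with d in p and c not in p. As c is not a multiple of d, d is a
    multiple ec with e in p, and cancelling c gives x = er. *)
Lemma extension_saturated p c x :
  prime_ideal p -> ~ p c -> extension p (c *: x) -> extension p x.
Proof.
move=> pprime npc [d pd [r cx]].
have /prime_idealP [[p0 _ pM] _ _] := pprime.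
have [[e de]|[e ce]] := divides_total c d; last first.
  by case: npc; rewrite ce; apply: (pM _ _ _).1.
have : c *: (x - e *: r) = 0 by rewrite scalerBr cx scalerA mulrC -de subrr.
case/tfR => [c0|/eqP]; first by case: npc; rewrite c0.
rewrite subr_eq0 => /eqP ->; exists e; last by exists r.
by have [] := prime_mul pprime (c:=e) (d:=c); rewrite -?de.
Qed.

(** The prime is chosen to contain pR and to avoid the products cx with c in
    O - p and x in M. As 1 is in M, it avoids O - p, so its contraction is p. *)
Lemma prime_over_avoiding p (M : set R) : prime_ideal p -> M 1 ->
  (forall x y, M x -> M y -> exists r, M (x * r * y)) ->
  (forall x, extension p x -> ~ M x) ->
  exists P : set R,
    [/\ prime_ideal P, contraction P = p & forall x, P x -> ~ M x].
Proof.
move=> pprime M1 MM pM.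
have /prime_idealP [idp np1 _] := pprime.
pose S := [set z | exists c x, [/\ ~ p c, M x & z = c *: x]].
have [| |_ _ [c [x [nc Mx ->]]] [d [y [nd My ->]]]|z pz [c [x [nc Mx zE]]]|
     P [primeP pP PS]] := @prime_ideal_avoiding R (extension p) S.
- exact: extension_ideal.
- by exists 1, 1; rewrite scale1r.
- have [r Mr] := MM x y Mx My; exists r, (c * d), (x * r * y); split=> //.
    by move/(prime_mul pprime) => [/nc|/nd].
  by rewrite -!scalerAl -scalerAr scalerA.
- by apply: (pM x) Mx; apply: extension_saturated nc _ => //; rewrite -zE.
exists P; split=> //; last first.
  by move=> x /PS Sx Mx; apply: Sx; exists 1, x; rewrite scale1r.
apply/seteqP; split=> c pc.
  apply: contrapT => npc; apply: (PS c%:A) => //.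
  by exists c, 1.
by apply: pP; exists c => //; exists 1.
Qed.

(** If 1 = dr with d in p, the unit d of R would be a unit of O. *)
Lemma lying_over p :
  (forall c, invertible (c%:A : R) -> invertible c) -> prime_ideal p ->
  exists2 P : set R, prime_ideal P & contraction P = p.
Proof.
move=> unitsR pprime.
have [|x y -> ->|z [d pd [r dr]] z1|P [primeP PO _]] :=
  @prime_over_avoiding p [set 1] pprime.
- by [].
- by exists 1; rewrite !mulr1.
- have [|e [de _]] := unitsR d.
    by exists r; rewrite mulr_algl mulr_algr -dr z1.
  have /prime_idealP [[_ _ pM] np1 _] := pprime.
  by apply: np1; rewrite -de; apply: (pM _ _ _).2.
by exists P.
Qed.

Lemma going_down p (Q : set R) : prime_ideal p -> prime_ideal Q ->
  p `<=` contraction Q ->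
  exists P : set R, [/\ prime_ideal P, contraction P = p & P `<=` Q].
Proof.
move=> pprime /prime_idealP [idQ Q1 Qprime] pQ.
have [//|x y nQx nQy|_ [d pd [r ->]]|P [primeP PO PQ]] :=
  @prime_over_avoiding p (~` Q) pprime.
- apply: contrapT => /forallNP H.
  have [r|//|//] := Qprime x y; exact: contrapT (H r).
- by apply; apply: idealZl => //; apply: pQ.
by exists P; split=> // x /PQ /contrapT.
Qed.

Lemma chain_going_down m (p : nat -> set O) (Q : set R) :
  prime_chain m p -> prime_ideal Q -> contraction Q = p m ->
  exists2 P : nat -> set R, prime_chain m P & P m = Q.
Proof.
elim: m Q => [|m IHm] Q [primep ltp] primeQ QO.
  by exists (fun=> Q).
have ltm := ltp m (ltnSn m).
have [|P' [primeP' PO P'Q]] := @going_down (p m) Q (primep m (leqnSn m)) primeQ.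
  by rewrite QO; apply: properW.
have [|P [primeP ltP] Pm] := IHm P' _ primeP' PO.
  by split=> i im; [apply/primep/leqW|apply/ltp/leqW].
exists (fun i => if (i <= m)%N then P i else Q); last by rewrite ltnn.
split=> i im.
  by case: ifP => // /primeP.
move: im; rewrite ltnS => im; rewrite im; case: (leqP i.+1 m) => [/ltP//|mi].
have {im mi} -> : i = m by apply/eqP; rewrite eqn_leq im.
rewrite Pm; split=> // QP'; case: ltm => _; apply.
by rewrite -QO -PO => c; apply: QP'.
Qed.

End GoingDown.

(** * Valuation rings *)

Section ValuationRings.
Local Open Scope classical_set_scope.
Variables (F : fieldType) (G : orderedGroup) (v : valuation F G).
Local Notation O := (valuation_ring v).

Lemma in_field_inj : injective (@in_field F G v).
Proof. exact: val_inj. Qed.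

Lemma in_fieldD (c d : O) : in_field (c + d) = in_field c + in_field d.
Proof. exact: (rmorphD val). Qed.

Lemma in_fieldM (c d : O) : in_field (c * d) = in_field c * in_field d.
Proof. exact: (rmorphM val). Qed.

Lemma in_field0 : in_field (0 : O) = 0.
Proof. exact: (rmorph0 val). Qed.

Lemma in_field1 : in_field (1 : O) = 1.
Proof. exact: (rmorph1 val). Qed.

Lemma nonneg_valueM (a b : F) :
  nonneg_value v a -> nonneg_value v b -> nonneg_value v (a * b).
Proof.
have [_ _ PM] := nonneg_value_subring v; exact: PM.
Qed.

Lemma valuation_le_div (a b : F) : b != 0 -> vle (v b) (v a) ->
  nonneg_value v (a / b).
Proof.
move=> b0; rewrite /nonneg_value.
have -> : v a = vadd (v (a / b)) (v b) by rewrite -valuationM divfK.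
case Eb: (v b) => [g|]; last by move/valuation_infty: Eb b0 => ->; rewrite eqxx.
case: (v (a / b)) => //= h gh.
by have := group_leD2r (- g) gh; rewrite subrr addrK.
Qed.

Lemma vle_total (a b : option G) : vle a b || vle b a.
Proof. by case: a b => [g|] [h|] //=; apply: group_le_total. Qed.

Lemma vle_trans (a b c : option G) : vle a b -> vle b c -> vle a c.
Proof. by case: a b c => [x|] [y|] [z|] //=; apply: Order.POrderTheory.le_trans. Qed.

Lemma valuation_ring_divides_total (c d : O) :
  (exists e, d = e * c) \/ (exists e, c = e * d).
Proof.
wlog cd : c d / vle (v (in_field c)) (v (in_field d)).
  move=> H; have /orP [/H//|/H [|]] := vle_total (v (in_field c)) (v (in_field d)).
    by right.
  by left.
have [c0|c0] := eqVneq (in_field c) 0.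
  by right; exists 0; rewrite mul0r; apply: in_field_inj.
left; exists (ValuationRing (valuation_le_div c0 cd)).
by apply: in_field_inj; rewrite in_fieldM /= divfK.
Qed.

Lemma valuation_ring_mul_neq0 (c d : O) : c != 0 -> d != 0 -> c * d != 0.
Proof.
by rewrite -!(inj_eq in_field_inj) in_fieldM in_field0 mulf_eq0 negb_or => -> ->.
Qed.

(** Every multiple of a denominator is one as well; this makes it possible to
    combine denominators by multiplication. *)
Lemma denominator (a : F) :
  exists2 c : O, c != 0 & forall e : O, nonneg_value v (in_field (e * c) * a).
Proof.
suff [c c0 Pca] : exists2 c : O, c != 0 & nonneg_value v (in_field c * a).
  by exists c => // e; rewrite in_fieldM -mulrA nonneg_valueM //; apply: valP.
have [Pa|nPa] := boolP (nonneg_value v a).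
  by exists 1; rewrite ?oner_neq0 // in_field1 mul1r.
have a0 : a != 0.
  apply: contraNneq nPa => ->; rewrite /nonneg_value.
  by have -> := (valuation_infty v 0).2 erefl.
have Pa' : nonneg_value v (1 / a).
  apply: valuation_le_div => //; rewrite valuation1.
  by have := vle_total (Some 0) (v a); rewrite [X in X || _](negbTE nPa).
exists (ValuationRing Pa').
  apply: contraNneq a0 => /(congr1 (@in_field _ _ v)) /eqP; rewrite in_field0 /=.
  by rewrite mulf_eq0 oner_eq0 invr_eq0.
by rewrite /= divfK // /nonneg_value valuation1 /=.
Qed.

End ValuationRings.

(** * Embedding of a torsion-free algebra in its tensor product with the field *)

(** To see that r is nonzero in the tensor product, a bilinear map that does not
    kill (r, 1) is needed. The expected target is the module of fractions of R.
    It is replaced by germs of functions O -> R, two functions being identified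
    when they agree on the multiples of some nonzero c: the fraction ra is
    represented by the function d |-> (da)r, which makes sense as soon as d is a
    denominator of a. *)
Section Germs.
Local Open Scope classical_set_scope.
Variables (F : fieldType) (G : orderedGroup) (v : valuation F G).
Local Notation O := (valuation_ring v).
Variable R : algType O.

Definition vanishes_near0 : {pred O -> R} :=
  fun g => `[< exists2 c : O, c != 0 & forall e, g (e * c) = 0 >].

Lemma vanishes_near0_zmod_closed : zmod_closed vanishes_near0.
Proof.
split=> [|g h /asboolP [c c0 gc] /asboolP [d d0 hd]]; apply/asboolP.
  by exists 1; rewrite ?oner_neq0.
exists (c * d) => [|e].
  exact: valuation_ring_mul_neq0.
have -> : (g - h) (e * (c * d)) = g (e * d * c) - h (e * c * d).
  by rewrite -mulrA (mulrC d) -mulrA.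
by rewrite gc hd subrr.
Qed.
HB.instance Definition _ :=
  GRing.isZmodClosed.Build (O -> R) vanishes_near0 vanishes_near0_zmod_closed.

Definition germ := Quotient.quot vanishes_near0.
HB.instance Definition _ := GRing.Zmodule.on germ.

Definition germ_of (g : O -> R) : germ := \pi_germ%qT g.

Lemma germ_ofP (g h : O -> R) :
  reflect (germ_of g = germ_of h) (g - h \in vanishes_near0).
Proof. by rewrite Quotient.idealrBE; apply: eqP. Qed.

Lemma germ_ofD (g h : O -> R) : germ_of (g + h) = germ_of g + germ_of h.
Proof. exact: raddfD. Qed.

Lemma germ_ofK (x : germ) : germ_of (repr x) = x.
Proof. exact: reprK. Qed.

Definition germ_scale (c : O) (x : germ) : germ := germ_of (c \*: repr x).

Lemma germ_scaleE c (g : O -> R) : germ_scale c (germ_of g) = germ_of (c *: g).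
Proof.
apply/germ_ofP; have /germ_ofP /asboolP [d d0 gd] := germ_ofK (germ_of g).
apply/asboolP; exists d => // e.
rewrite [LHS](_ : _ = c *: (repr (germ_of g) - g) (e * d)).
  by rewrite gd scaler0.
exact/esym/scalerBr.
Qed.

Fact germ_scaleA c d x : germ_scale c (germ_scale d x) = germ_scale (c * d) x.
Proof. by rewrite -(germ_ofK x) !germ_scaleE scalerA. Qed.

Fact germ_scale1 : left_id 1 germ_scale.
Proof. by move=> x; rewrite -(germ_ofK x) germ_scaleE scale1r. Qed.

Fact germ_scaleDr : right_distributive germ_scale +%R.
Proof.
move=> c x y; rewrite -(germ_ofK x) -(germ_ofK y).
by rewrite -germ_ofD !germ_scaleE scalerDr germ_ofD.
Qed.

Fact germ_scaleDl x : {morph germ_scale^~ x : c d / c + d}.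
Proof.
by move=> c d; rewrite -(germ_ofK x) !germ_scaleE scalerDl germ_ofD.
Qed.

HB.instance Definition _ := GRing.Zmodule_isLmodule.Build O germ
  germ_scaleA germ_scale1 germ_scaleDr germ_scaleDl.

(** The value 0 outside the denominators of a does not affect the germ. *)
Definition scaled (a : F) (d : O) : O := insubd 0 (in_field d * a).

Lemma scaledK (a : F) (d : O) :
  nonneg_value v (in_field d * a) -> in_field (scaled a d) = in_field d * a.
Proof. exact: insubdK. Qed.

Definition fraction_germ (r : R) (a : F) : germ :=
  germ_of (fun d => scaled a d *: r).

Lemma fraction_germ_bilinear : bilinear_map fraction_germ.
Proof.
split=> [r s a|r a b|c r a|c r a].
- rewrite -germ_ofD; congr germ_of; apply/funext => d; exact: scalerDr.
- rewrite -germ_ofD; apply/germ_ofP/asboolP.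
  have [c c0 Pa] := denominator v a; have [d d0 Pb] := denominator v b.
  exists (c * d) => [|e]; first exact: valuation_ring_mul_neq0.
  set x := e * (c * d).
  have Pxa : nonneg_value v (in_field x * a).
    by rewrite /x (mulrC c) mulrA; apply: Pa.
  have Pxb : nonneg_value v (in_field x * b) by rewrite /x mulrA; apply: Pb.
  have Pxab : nonneg_value v (in_field x * (a + b)).
    rewrite mulrDr -(scaledK Pxa) -(scaledK Pxb) -in_fieldD.
    exact: (valP (scaled a x + scaled b x)).
  rewrite [LHS](_ : _ = scaled (a + b) x *: r -
    (scaled a x *: r + scaled b x *: r)) //.
  have -> : scaled (a + b) x = scaled a x + scaled b x.
    by apply: in_field_inj; rewrite in_fieldD !scaledK // mulrDr.
  by rewrite scalerDl subrr.
- rewrite [RHS]germ_scaleE; congr germ_of; apply/funext => d.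
  by rewrite scalerA mulrC -scalerA.
- rewrite [RHS]germ_scaleE; apply/germ_ofP/asboolP.
  have [d d0 Pa] := denominator v a; exists d => // e; set x := e * d.
  have Pxa : nonneg_value v (in_field x * a) := Pa e.
  have Pxca : nonneg_value v (in_field x * (in_field c * a)).
    rewrite mulrCA -(scaledK Pxa) -in_fieldM.
    exact: (valP (c * scaled a x)).
  rewrite [LHS](_ : _ = scaled (in_field c * a) x *: r - c *: (scaled a x *: r)) //.
  have -> : scaled (in_field c * a) x = c * scaled a x.
    apply: in_field_inj.
    by rewrite in_fieldM (scaledK Pxa) (scaledK Pxca) mulrCA.
  by rewrite scalerA subrr.
Qed.

Lemma tensor_injective (T : algType F) (t : R -> F -> T) (r : R) :
  torsion_free R -> is_tensor_algebra t -> t r 1 = 0 -> r = 0.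
Proof.
move=> tfR tensor tr.
have [g [[_ gt] _]] := tensor_universal tensor fraction_germ_bilinear.
have t0 : t 0 1 = 0.
  by apply: (addrI (t 0 1)); rewrite -(tensorDl tensor) !addr0.
have /germ_ofP/asboolP [c c0 /(_ 1)] : fraction_germ r 1 = fraction_germ 0 1.
  by rewrite -!gt tr t0.
rewrite [X in X = 0](_ : _ = scaled 1 (1 * c) *: r - scaled 1 (1 * c) *: 0) //.
rewrite scaler0 subr0 mul1r (_ : scaled 1 c = c) => [/tfR [c0'|//]|].
  by rewrite c0' eqxx in c0.
by apply: in_field_inj; rewrite scaledK mulr1 //; apply: valP.
Qed.

End Germs.

(** * Linear relations with a unit coefficient *)

Section Relations.
Variables (F : fieldType) (G : orderedGroup) (v : valuation F G).
Local Notation O := (valuation_ring v).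

(** A linear relation over F between the images in T is divided by its
    coefficient of least value; T contains R, so it holds in R. *)
Lemma unit_coefficient_relation (R : algType O) (T : falgType F) (t : R -> F -> T)
    (s : seq R) :
  torsion_free R -> is_tensor_algebra t -> (\dim {:T} < size s)%N ->
  exists c : nat -> O,
    \sum_(i < size s) c i *: s`_i = 0 /\ exists2 i, (i < size s)%N & c i = 1.
Proof.
move=> tfR tensor dims.
pose X := [tuple t s`_i 1 | i < size s].
have nfreeX : ~~ free X.
  apply: contraL dims => /eqP freeX; rewrite -leqNgt -(size_tuple X) -freeX.
  exact/dimvS/subvf.
have [k sumk [i1 ki1]] : exists2 k : 'I_(size s) -> F,
    \sum_(i < size s) k i *: t s`_i 1 = 0 & exists i, k i != 0.
  apply: contrapT => nok; case/freeP: nfreeX => k.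
  under eq_bigr do rewrite -tnth_nth tnth_mktuple.
  move=> sumk i; apply/eqP; rewrite -[_ == _]negbK; apply/negP => ki.
  by apply: nok; exists k => //; exists i.
have [i imin] : exists i, forall j, vle (v (k i)) (v (k j)).
  have [|b a c|a b|//|i _ imin] :=
    @extremumP (option G) _ (@vle G) i1 predT (v \o k).
  - by move=> a; have := vle_total a a; rewrite orbb.
  - exact: vle_trans.
  - exact: vle_total.
  - by exists i => j; apply: imin.
have ki : k i != 0.
  apply: contraNneq ki1 => ki; have := imin i1.
  rewrite ki (valuation_infty v 0).2 //.
  by case E: (v (k i1)) => [g|] //= _; apply/eqP/(valuation_infty v).
pose c (j : 'I_(size s)) : O := ValuationRing (valuation_le_div ki (imin j)).
pose c' j := if insub j is Some j' then c j' else 0.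
have c'E (j : 'I_(size s)) : c' j = c j by rewrite /c' valK.
exists c'; split; last first.
  by exists i => //; rewrite c'E; apply: in_field_inj; rewrite /= divff.
apply: (tensor_injective tfR tensor).
have tD : {morph t^~ 1 : x y / x + y} by move=> x y; apply: (tensorDl tensor).
have t0 : t 0 1 = 0.
  by apply: (addrI (t 0 1)); rewrite -(tensorDl tensor) !addr0.
rewrite (big_morph _ tD t0).
transitivity ((k i)^-1 *: \sum_(j < size s) k j *: t s`_j 1);
  last by rewrite sumk scaler0.
rewrite scaler_sumr; apply: eq_bigr => j _.
by rewrite scalerA (tensorZ tensor) c'E (tensor_balanced tensor) /= (mulrC (k j)).
Qed.

End Relations.

Theorem corollary3p3 (F : fieldType) (G : orderedGroup) (v : valuation F G)
    (R : algType (valuation_ring v)) (T : falgType F) (t : R -> F -> T) :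
  nontrivial_valuation v ->
  torsion_free R ->
  (forall c : valuation_ring v, invertible (c%:A : R) -> invertible c) ->
  is_tensor_algebra t ->
  Kdim R = Kdim (valuation_ring v).
Proof.
move=> _ tfR unitsR tensor.
suff lengths : prime_chain_lengths R = prime_chain_lengths (valuation_ring v).
  by rewrite /Kdim lengths.
apply/seteqP; split=> m [P [primeP ltP]].
  exists (fun i => contraction (P i)); split=> i im.
    exact/contraction_prime/primeP.
  apply: (incomparability (n := \dim {:T})).
  - move=> s; exact: unit_coefficient_relation tfR tensor.
  - exact/primeP/ltnW.
  - exact: primeP.
  - exact: ltP.
have dvd := @valuation_ring_divides_total F G v.
have [Q primeQ QO] := lying_over tfR dvd unitsR (primeP m (leqnn m)).
have [|P' chainP' _] := chain_going_down tfR dvd (m := m) (p := P) _ primeQ QO.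
  by [].
by exists P'.
Qed.
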